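(* Let $f,g:Q\to\mathbb{R}$ be convex functions, $M_f>0$, $M_g>0$, and let $\varepsilon>0$, $\delta>0$ be fixed positive numbers, such that for all $x,y\in Q$ $$f(x)+\psi_f(y,x)\le f(y),\qquad -\psi_f(y,x)\le M_f\sqrt{2V_d(y,x)}+\delta,$$ $$g(x)+\psi_g(y,x)\le g(y),\qquad -\psi_g(y,x)\le M_g\sqrt{2V_d(y,x)}+\delta,$$ where $\psi_f(y,x),\psi_g(y,x)$ are convex in $y$ and $\psi_f(x,x)=\psi_g(x,x)=0$ for every $x\in Q$. Let $x^*$ be a solution of $\min\{f(x):x\in Q,\ g(x)\le 0\}$ and let $\Theta_0>0$ be a known constant such that $d(x^* )\le\Theta_0^2$. Then, after the stopping of Algorithm B (described in the context), its output $\widehat{x}$ satisfies $$f(\widehat{x})-f(x^* )\le M_f\varepsilon+\delta\quad\text{and}\quad g(\widehat{x})\le M_g\varepsilon+\delta.$$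
   Context: $(E,\|\cdot\|)$ is a finite-dimensional normed space, $Q\subset E$ is a closed convex set, and $f,g:Q\to\mathbb{R}$ are subdifferentiable. The reference function $d:Q\to\mathbb{R}$ is any convex (not necessarily strongly convex) differentiable function. The Bregman divergence is $V_d(y,x)=d(y)-d(x)-\langle\nabla d(x),y-x\rangle$ for $x,y\in Q$. Proximal mapping: for $h>0$, $\mathrm{Mirr}_h(x,\psi)=\arg\min_{y\in Q}\{\psi(y,x)+\frac1h V_d(y,x)\}$. Algorithm B. Input: $\varepsilon>0$, $\delta>0$, $M_f>0$, $M_g>0$, $\Theta_0$ with $d(x^* )\le\Theta_0^2$. Start from $x^0=\arg\min_{x\in Q}d(x)$, $I=\emptyset$, $N=0$. Repeat: if $g(x^N)\le M_g\varepsilon+\delta$, set $h^f=\frac{\varepsilon}{M_f}$, $x^{N+1}=\mathrm{Mirr}_{h^f}(x^N,\psi_f)$ and add $N$ to $I$ (productive step); otherwise set $h^g=\frac{\varepsilon}{M_g}$, $x^{N+1}=\mathrm{Mirr}_{h^g}(x^N,\psi_g)$ (non-productive step); then increase $N$ by 1; until $N\ge\frac{2\Theta_0^2}{\varepsilon^2}$. Output $\widehat{x}=\frac1{|I|}\sum_{k\in I}x^k$.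
   Formalization: The reference function d is additionally assumed nonnegative on Q (the usual normalization); without it the claim fails, since adding a negative constant to d leaves V_d unchanged but makes d(x* ) ≤ Θ_0² vacuous. *)

(* Defs.v *)
From HB Require Import structures.
From mathcomp Require Import all_boot all_order all_algebra.
From mathcomp Require Import all_classical all_reals all_analysis.

Set Implicit Arguments.
Unset Strict Implicit.
Unset Printing Implicit Defensive.

Import Order.TTheory GRing.Theory Num.Theory.
Import numFieldNormedType.Exports.

Local Open Scope classical_set_scope.
Local Open Scope ring_scope.

(* A function Q -> R on a subset Q of E is represented by a total function
   E -> R of which only the values on Q are used. *)

Definition argmin (R : realType) (T : Type) (A : set T) (phi : T -> R) : set T :=
  [set x | A x /\ forall y, A y -> phi x <= phi y].

Section Bregman.
Context (R : realType) (E : normedModType R) (Q : set E).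

(* E is finite-dimensional wherever this is used, so its dual consists of all
   linear forms. *)
Definition subdifferential (f : E -> R) (x : E) : set {linear E -> R^o} :=
  [set p | forall y, Q y -> f x + p (y - x) <= f y].

Definition subdifferentiable (f : E -> R) :=
  forall x, Q x -> subdifferential f x !=set0.

(* Differentiability relative to Q: the expansion
     d y = d x + <grad, y - x> + o(|y - x|)
   is required only as y tends to x inside Q, so that d need not extend
   differentiably outside Q when x is on the boundary. *)
Definition differentiable_on (d : E -> R) :=
  forall x, Q x -> differentiable (d : E -> R^o) (within Q (nbhs x)).

(* When Q has empty interior the gradient at x need not be unique, and 'd
   picks one of the candidates.  For Q convex and y in Q all candidates take
   the same value at y - x (the derivative of d at x along [x, y]), so the
   choice does not affect the divergence. *)
Definition bregman (d : E -> R) (y x : E) : R :=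
  d y - d x - 'd (d : E -> R^o) (within Q (nbhs x)) (y - x).

(* The set of minimizers, as d is not assumed to be strictly convex. *)
Definition mirr (d : E -> R) (h : R) (x : E) (psi : E -> E -> R) : set E :=
  argmin Q (fun y => psi y x + h^-1 * bregman d y x).

End Bregman.

Section AlgorithmB.
Context (R : realType) (E : normedModType R) (Q : set E).
Context (d g : E -> R) (psi_f psi_g : E -> E -> R).
Context (eps delta M_f M_g Theta0 : R).

Definition productive (x : E) : bool := g x <= M_g * eps + delta.

Definition algoB_stop (N : nat) : bool :=
  2 * Theta0 ^+ 2 / eps ^+ 2 <= N%:R.

(* x 0, ..., x N are the iterates of a run that stops after N passes through
   the repeat-until loop.  The values of x beyond N are irrelevant. *)
Record algoB_run (x : nat -> E) (N : nat) : Prop := AlgoBRun {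
  algoB_init : argmin Q d (x 0%N) ;
  algoB_step : forall k, (k < N)%N ->
    if productive (x k) then mirr Q d (eps / M_f) (x k) psi_f (x k.+1)
    else mirr Q d (eps / M_g) (x k) psi_g (x k.+1) ;
  algoB_loop : (0 < N)%N ;
  algoB_continue : forall k, (0 < k < N)%N -> ~~ algoB_stop k ;
  algoB_until : algoB_stop N }.

Definition algoB_I (x : nat -> E) (N : nat) : seq nat :=
  [seq k <- iota 0 N | productive (x k)].

Definition algoB_output (x : nat -> E) (N : nat) : E :=
  (size (algoB_I x N))%:R^-1 *: \sum_(k <- algoB_I x N) x k.

End AlgorithmB.

(* Main.v *)
(* Write V_k = V_d(xstar, x_k).  First-order optimality of the mirror step gives
   h psi(z, x) + V_d(z, x) + V_d(y, z) <= h psi(y, x) + V_d(y, x), and with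
   h = eps / M and AM-GM applied to M sqrt(2 V_d(z, x)) this becomes
     h (- psi(xstar, x_k) - delta) <= eps^2 / 2 + V_k - V_(k+1).
   Hence the excesses h_f (f(x_k) - f(xstar) - delta) - eps^2 over productive k
   and h_g (g(x_k) - delta) - eps^2 over non-productive k sum to at most
   V_0 - V_N - N eps^2 / 2 <= Theta0^2 - N eps^2 / 2 <= 0.  The non-productive
   excesses are positive, so some step is productive and the productive excesses
   have sum <= 0; Jensen's inequality concludes. *)
Require Import Defs.
From HB Require Import structures.
From mathcomp Require Import all_boot all_order all_algebra.
From mathcomp Require Import all_classical all_reals all_analysis.
From mathcomp Require Import ring lra.

Import Order.TTheory GRing.Theory Num.Theory.
Import numFieldNormedType.Exports.

Local Open Scope classical_set_scope.
Local Open Scope ring_scope.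

Lemma convex_set_segment {R : realType} {E : lmodType R} {Q : set E} {x y : E}
    {t : R} :
  convex_set Q -> Q x -> Q y -> 0 <= t <= 1 -> Q (x + t *: (y - x)).
Proof.
move=> hQ Qx Qy /andP[t0 t1].
have := hQ y x (Itv01 t0 t1); rewrite !inE => /(_ Qy Qx).
by rewrite /conv/= scalerBl scale1r scalerBr addrCA addrA.
Qed.

Lemma convex_function_segment {R : realType} {E : lmodType R} {Q : set E}
    {f : E -> R} {x y : E} {t : R} :
  convex_function Q f -> Q x -> Q y -> 0 <= t <= 1 ->
  f (x + t *: (y - x)) <= f x + t * (f y - f x).
Proof.
move=> hf Qx Qy /andP[t0 t1].
have -> : x + t *: (y - x) = t *: y + (1 - t) *: x.
  by rewrite scalerBl scale1r scalerBr addrCA.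
have -> : f x + t * (f y - f x) = t * f y + (1 - t) * f x by ring.
by apply: (hf (Itv01 t0 t1) y x); rewrite inE.
Qed.

(** By induction: with [n = size s], the mean of [i :: s] lies on the segment from the mean of [s]
    to [x i], at parameter [1 / (n + 1)]. *)
Lemma convex_set_mean {R : realType} {E : lmodType R} {Q : set E} {I : eqType}
    {s : seq I} {x : I -> E} :
  convex_set Q -> s != [::] -> {in s, forall i, Q (x i)} ->
  Q ((size s)%:R^-1 *: \sum_(i <- s) x i).
Proof.
move=> hQ; elim: s => [//|i s IH] _ Qs.
have Qi : Q (x i) by apply: Qs; rewrite mem_head.
have [->|s0] := eqVneq s [::]; first by rewrite big_seq1 invr1 scale1r.
have Qm : Q ((size s)%:R^-1 *: \sum_(j <- s) x j).
  by apply: IH => // j js; apply: Qs; rewrite inE js orbT.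
have n0 : (size s)%:R != 0 :> R by rewrite pnatr_eq0 size_eq0.
have n1 : (size s).+1%:R != 0 :> R by rewrite pnatr_eq0.
rewrite big_cons/=.
have -> : (size s).+1%:R^-1 *: (x i + \sum_(j <- s) x j) =
    (size s)%:R^-1 *: (\sum_(j <- s) x j) +
    (size s).+1%:R^-1 *: (x i - (size s)%:R^-1 *: \sum_(j <- s) x j).
  rewrite scalerBr addrCA scalerDr; congr (_ + _).
  rewrite scalerA -scalerBl; congr (_ *: _).
  by move: n1; rewrite -natr1 => n1; field; rewrite n0 n1.
apply: convex_set_segment => //.
by rewrite invr_ge0 ler0n/= invf_le1 ?ler1n ?ltr0n.
Qed.

(** Jensen's inequality from a single subgradient [p] at the mean [m]: in the sum of
    [f m + p (x i - m) <= f (x i)] the linear terms cancel. *)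
Lemma subdifferentiable_mean {R : realType} {E : normedModType R} {Q : set E}
    {f : E -> R} {I : eqType} {s : seq I} {x : I -> E} :
  convex_set Q -> subdifferentiable Q f ->
  s != [::] -> {in s, forall i, Q (x i)} ->
  f ((size s)%:R^-1 *: \sum_(i <- s) x i) * (size s)%:R <= \sum_(i <- s) f (x i).
Proof.
move=> hQ hf s0 Qs; set m := _ *: _.
have [p pf] := hf m (convex_set_mean hQ s0 Qs).
have -> : f m * (size s)%:R = \sum_(i <- s) (f m + p (x i - m)).
  rewrite big_split/= -raddf_sum/= sumrB !big_const_seq count_predT.
  rewrite !iter_addr_0 -[m *+ _]scaler_nat /m scalerA mulfV.
    by rewrite scale1r subrr raddf0 addr0 mulr_natr.
  by rewrite pnatr_eq0 size_eq0.
by rewrite big_seq [leRHS]big_seq; apply: ler_sum => i si; apply: pf; apply: Qs.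
Qed.

(** By convexity the segment from [x] to [y] stays in [Q], so the expansion relative to [Q] applies
    along it. All first-order arguments below pass to this limit of slopes. *)
Lemma cvg_slope_within {R : realType} {E : normedModType R} {Q : set E}
    {d : E -> R} {x y : E} :
  convex_set Q -> differentiable_on Q d -> Q x -> Q y ->
  t^-1 * (d (x + t *: (y - x)) - d x) @[t --> 0^'+] -->
  'd (d : E -> R^o) (within Q (nbhs x)) (y - x).
Proof.
move=> hQ hd Qx Qy.
(* The differential along a filter expands around the [lim] of that filter, which must first be
   identified with [x]. *)
have limQ : lim (within Q (nbhs x)) = x.
  have ? : ProperFilter (within Q (nbhs x)).
    exact/within_nbhs_proper/subset_closure.
  by apply: norm_cvg_lim; exact: cvg_within.
have seg : x + t *: (y - x) @[t --> (0 : R)^'+] --> x.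
  rewrite -[X in _ --> X]addr0 -(scale0r (y - x)).
  apply: cvgD; first exact: cvg_cst.
  by apply: cvgZr_tmp; exact/cvg_at_right_filter/cvg_id.
have [[_ /eqaddoP dx]] := hd x Qx.
apply/cvgrPdist_le => e e0.
(* The [+ 1] keeps the denominator of the tolerance positive when [y = x]. *)
have n0 : 0 < `|y - x| + 1 by rewrite ltr_wpDl.
set D := 'd (d : E -> R^o) (within Q (nbhs x)).
have near_seg : \forall t \near (0 : R)^'+, Q (x + t *: (y - x)) ->
    `|d (x + t *: (y - x)) - (d x + D (x + t *: (y - x) - x))| <=
    e / (`|y - x| + 1) * `|x + t *: (y - x) - x|.
  have := seg _ (dx _ (divr_gt0 e0 n0)).
  by apply: (@filterS _ (0^'+)) => t; rewrite limQ.
apply: filterS3 (nbhs_right_gt 0) (nbhs_right_lt ltr01) near_seg => t t0 t1.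
have t01 : 0 <= t <= 1 by rewrite !ltW.
move=> /(_ (convex_set_segment hQ Qx Qy t01)).
rewrite [x + _ - x]addrAC subrr add0r linearZ/= normrZ gtr0_norm// => dt.
have -> : D (y - x) - t^-1 * (d (x + t *: (y - x)) - d x) =
   - t^-1 * (d (x + t *: (y - x)) - (d x + t * D (y - x))).
  by field; rewrite gt_eqF.
rewrite normrM normrN (gtr0_norm (_ : 0 < t^-1)) ?invr_gt0// ler_pdivrMl//.
apply: (le_trans dt); rewrite mulrCA ler_pM2l// mulrAC ler_pdivrMr//.
by rewrite ler_pM2l// lerDl.
Qed.

(** Convexity bounds each slope of [d] from [x] towards [y] by [d y - d x], and the bound survives
    in the limit. *)
Lemma bregman_ge0 {R : realType} {E : normedModType R} {Q : set E} {d : E -> R}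
    {x y : E} :
  convex_set Q -> convex_function Q d -> differentiable_on Q d ->
  Q x -> Q y -> 0 <= bregman Q d y x.
Proof.
move=> hQ hdc hd Qx Qy; rewrite /bregman subr_ge0.
apply: (cvgr_to_le (cvg_slope_within hQ hd Qx Qy)).
apply: filterS2 (nbhs_right_gt 0) (nbhs_right_lt ltr01) => t t0 t1.
rewrite ler_pdivrMl// lerBlDl.
by apply: (convex_function_segment hdc); rewrite ?ltW.
Qed.

(** Slopes at a minimizer are nonnegative, hence so is the derivative term that the divergence
    subtracts. This serves to bound the initial divergence. *)
Lemma bregman_argmin {R : realType} {E : normedModType R} {Q : set E}
    {d : E -> R} {x y : E} :
  convex_set Q -> differentiable_on Q d ->
  argmin Q d x -> Q y -> bregman Q d y x <= d y - d x.
Proof.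
move=> hQ hd [Qx minx] Qy; rewrite /bregman gerBl.
apply: (cvgr_to_ge (cvg_slope_within hQ hd Qx Qy)).
apply: filterS2 (nbhs_right_gt 0) (nbhs_right_lt ltr01) => t t0 t1.
apply: mulr_ge0; [by rewrite invr_ge0 ltW|rewrite subr_ge0].
by apply/minx/convex_set_segment; rewrite ?ltW.
Qed.

(* By the first-order optimality condition at [z]:
   [h * (psi y x - psi z x) + <d'(z) - d'(x), y - z> >= 0]. *)
Lemma mirr_three_points {R : realType} {E : normedModType R} {Q : set E}
    {d : E -> R} {psi : E -> E -> R} {h : R} {x y z : E} :
  convex_set Q -> differentiable_on Q d -> convex_function Q (psi ^~ x) ->
  0 < h -> Q x -> Q y -> mirr Q d h x psi z ->
  h * psi z x + bregman Q d z x + bregman Q d y z <=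
  h * psi y x + bregman Q d y x.
Proof.
move=> hQ hd hpsi h0 Qx Qy [Qz minz].
rewrite /bregman.
set Dx := 'd (d : E -> R^o) (within Q (nbhs x)).
set Dz := 'd (d : E -> R^o) (within Q (nbhs z)).
(* All values of [d] cancel from the three divergences, which leaves this inequality between
   differentials. *)
suff : h * (psi z x - psi y x) + Dx (y - z) <= Dz (y - z).
  have -> : Dx (y - x) = Dx (y - z) + Dx (z - x) by rewrite -raddfD/= subrKA.
  lra.
(* Minimality of [z] is tested against [z + t *: (y - z)]; convexity of [psi] makes the change in
   [psi] at most linear in [t], so dividing by [t] bounds the slope of [d] from below. *)
apply: (cvgr_to_ge (cvg_slope_within hQ hd Qz Qy)).
apply: filterS2 (nbhs_right_gt 0) (nbhs_right_lt ltr01) => t t0 t1.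
have t01 : 0 <= t <= 1 by rewrite !ltW.
rewrite ler_pdivlMl//.
have Dxt : Dx (z + t *: (y - z) - x) = Dx (z - x) + t * Dx (y - z).
  by rewrite addrAC linearD linearZ.
have := ler_wpM2l (ltW h0) (minz _ (convex_set_segment hQ Qz Qy t01)) => /=.
rewrite [leLHS]mulrDr [leRHS]mulrDr !mulVKf ?gt_eqF// /bregman -/Dx Dxt.
have := ler_wpM2l (ltW h0) (convex_function_segment hpsi Qz Qy t01).
lra.
Qed.

Lemma mirr_step {R : realType} {E : normedModType R} {Q : set E} {d : E -> R}
    {psi : E -> E -> R} {M eps delta : R} {x y z : E} :
  convex_set Q -> convex_function Q d -> differentiable_on Q d ->
  convex_function Q (psi ^~ x) -> 0 < M -> 0 < eps -> Q x -> Q y ->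
  - psi z x <= M * Num.sqrt (2 * bregman Q d z x) + delta ->
  mirr Q d (eps / M) x psi z ->
  eps / M * (- psi y x - delta) <=
  eps ^+ 2 / 2 + bregman Q d y x - bregman Q d y z.
Proof.
move=> hQ hdc hd hpsi M0 eps0 Qx Qy psiz hz.
have h0 : 0 < eps / M by rewrite divr_gt0.
have := mirr_three_points hQ hd hpsi h0 Qx Qy hz.
have Vz : 0 <= 2 * bregman Q d z x.
  by rewrite mulr_ge0// (bregman_ge0 hQ hdc hd)//; case: hz.
move: psiz; rewrite -(ler_pM2l h0).
have := sqr_sqrtr Vz; set s := Num.sqrt _ => s2.
have -> : eps / M * (M * s + delta) = eps * s + eps / M * delta.
  by field; rewrite gt_eqF.
(* AM-GM: [eps * s <= eps ^+ 2 / 2 + s ^+ 2 / 2], where [s ^+ 2 / 2] is exactly the divergence of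
   [z] from [x] supplied by the three-point inequality. *)
have := sqr_ge0 (eps - s).
nra.
Qed.

Lemma algoB_iterates {R : realType} {E : normedModType R} {Q : set E}
    {d g : E -> R} {psi_f psi_g : E -> E -> R} {eps delta M_f M_g Theta0 : R}
    {x : nat -> E} {N : nat} :
  algoB_run Q d g psi_f psi_g eps delta M_f M_g Theta0 x N ->
  forall k, (k <= N)%N -> Q (x k).
Proof.
by case=> -[Q0 _] step _ _ _ [//|k] /step; case: ifP => _ [].
Qed.

Theorem theorem2p1 (R : realType) (E : normedModType R)
    (dimE : nat) (hE : Vector.axiom dimE E)
    (Q : set E) (hQclosed : closed Q) (hQconvex : convex_set Q)
    (d : E -> R) (hdconvex : convex_function Q d)
    (hddiff : differentiable_on Q d)
    (hdnonneg : forall x, Q x -> 0 <= d x)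
    (f g : E -> R)
    (hfconvex : convex_function Q f) (hgconvex : convex_function Q g)
    (hfsubdiff : subdifferentiable Q f) (hgsubdiff : subdifferentiable Q g)
    (M_f M_g eps delta : R)
    (hM_f : 0 < M_f) (hM_g : 0 < M_g) (heps : 0 < eps) (hdelta : 0 < delta)
    (psi_f psi_g : E -> E -> R)
    (hf1 : forall x y, Q x -> Q y -> f x + psi_f y x <= f y)
    (hf2 : forall x y, Q x -> Q y ->
      - psi_f y x <= M_f * Num.sqrt (2 * bregman Q d y x) + delta)
    (hg1 : forall x y, Q x -> Q y -> g x + psi_g y x <= g y)
    (hg2 : forall x y, Q x -> Q y ->
      - psi_g y x <= M_g * Num.sqrt (2 * bregman Q d y x) + delta)
    (hpsi_fconvex : forall x, Q x -> convex_function Q (fun y => psi_f y x))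
    (hpsi_gconvex : forall x, Q x -> convex_function Q (fun y => psi_g y x))
    (hpsi_f0 : forall x, Q x -> psi_f x x = 0)
    (hpsi_g0 : forall x, Q x -> psi_g x x = 0)
    (xstar : E) (hxstar : argmin [set x | Q x /\ g x <= 0] f xstar)
    (Theta0 : R) (hTheta0 : 0 < Theta0) (hdxstar : d xstar <= Theta0 ^+ 2)
    (x : nat -> E) (N : nat)
    (hrun : algoB_run Q d g psi_f psi_g eps delta M_f M_g Theta0 x N) :
  let xhat := algoB_output g eps delta M_g x N in
  [/\ algoB_I g eps delta M_g x N != [::],
      f xhat - f xstar <= M_f * eps + delta
    & g xhat <= M_g * eps + delta].
Proof.
case: hxstar => -[Qs gs] fs xhat; set I := algoB_I _ _ _ _ _ _.
have Qx := algoB_iterates hrun.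
have [init step N0 _ stop] := hrun.
pose p k := productive g eps delta M_g (x k).
pose V k := bregman Q d xstar (x k).
pose a k := eps / M_f * (f (x k) - f xstar - delta) - eps ^+ 2.
pose b k := eps / M_g * (g (x k) - delta) - eps ^+ 2.
(* A failed test means [g (x k) - delta > M_g * eps]; scaling by [eps / M_g] gives [eps ^+ 2]. *)
have b_gt0 k : ~~ p k -> 0 < b k.
  rewrite /p /productive -ltNge => gk.
  rewrite subr_gt0 mulrAC ltr_pdivlMr// exprS expr1 -mulrA ltr_pM2l//; lra.
have hstep k : (k < N)%N ->
    (if p k then a k else b k) <= - (V k.+1 - V k) - eps ^+ 2 / 2.
  move=> kN; have Qk := Qx k (ltnW kN); have Qk1 := Qx k.+1 kN.
  move: (step k kN); rewrite -/(p k); case: ifP => _ hk.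
    have := mirr_step hQconvex hdconvex hddiff (hpsi_fconvex _ Qk) hM_f heps
      Qk Qs (hf2 _ _ Qk Qk1) hk.
    have : eps / M_f * (f (x k) - f xstar - delta) <=
        eps / M_f * (- psi_f xstar (x k) - delta).
      by rewrite ler_pM2l ?divr_gt0//; have := hf1 _ _ Qk Qs; lra.
    rewrite -/(V k) -/(V k.+1) /a; lra.
  have := mirr_step hQconvex hdconvex hddiff (hpsi_gconvex _ Qk) hM_g heps
    Qk Qs (hg2 _ _ Qk Qk1) hk.
  (* Feasibility [g xstar <= 0] lets [g xstar] be dropped here. *)
  have : eps / M_g * (g (x k) - delta) <=
      eps / M_g * (- psi_g xstar (x k) - delta).
    by rewrite ler_pM2l ?divr_gt0//; have := hg1 _ _ Qk Qs; lra.
  rewrite -/(V k) -/(V k.+1) /b; lra.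
have sum_le0 : \sum_(0 <= k < N) (if p k then a k else b k) <= 0.
  apply: (@le_trans _ _
    (\sum_(0 <= k < N) (- (V k.+1 - V k) - eps ^+ 2 / 2))).
    by apply: ler_sum_nat => k /andP[_]; exact: hstep.
  rewrite sumrB sumrN telescope_sumr// sumr_const_nat subn0.
  (* Here [d (x 0) >= 0] turns [d xstar - d (x 0)] into a bound by [Theta0 ^+ 2]. *)
  have V0 : V 0%N <= Theta0 ^+ 2.
    have := bregman_argmin hQconvex hddiff init Qs.
    have := hdnonneg _ (Qx 0%N isT).
    rewrite /V; lra.
  have VN : 0 <= V N by apply: bregman_ge0 => //; exact: Qx.
  have : Theta0 ^+ 2 <= eps ^+ 2 / 2 *+ N.
    move: stop; rewrite /algoB_stop ler_pdivrMr ?exprn_gt0// -mulr_natr.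
    lra.
  lra.
have I_N0 : I != [::].
  apply/eqP => I0; move: sum_le0; apply/negP; rewrite -ltNge.
  have pF k : (k < N)%N -> p k = false.
    move=> kN; apply/negbTE; apply/negP => pk.
    have : k \in I by rewrite mem_filter mem_iota/= kN andbT.
    by rewrite I0.
  have nth_gt0 k : (k < N)%N -> 0 < (if p k then a k else b k).
    by move=> kN; rewrite pF// b_gt0// pF.
  (* The loop body runs at least once, so the sum has a first term, which makes it strictly
     positive. *)
  rewrite big_ltn//; apply: ltr_wpDr; last exact: nth_gt0.
  by rewrite big_nat; apply: sumr_ge0 => k /andP[_ kN]; rewrite ltW// nth_gt0.
have QI : {in I, forall k, Q (x k)}.
  by move=> k; rewrite mem_filter mem_iota => /andP[_ /andP[_ /ltnW]]; exact: Qx.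
have n0 : 0 < (size I)%:R :> R by rewrite ltr0n lt0n size_eq0.
split => //.
- have sum_a : \sum_(k <- I) a k <= 0.
    (* Restricting the sum to [I] replaces the positive non-productive terms by 0. *)
    apply: le_trans sum_le0; rewrite /I /algoB_I big_filter big_mkcond.
    rewrite /index_iota subn0; apply: ler_sum => k _; rewrite -/(p k).
    by case: ifPn => // /b_gt0/ltW.
  have h0 : 0 < eps / M_f by rewrite divr_gt0.
  have sum_f : \sum_(k <- I) f (x k) <=
      (M_f * eps + delta + f xstar) * (size I)%:R.
    rewrite -(ler_pM2l h0) -subr_le0 mulr_sumr.
    have -> : eps / M_f * ((M_f * eps + delta + f xstar) * (size I)%:R) =
        \sum_(k <- I) (eps / M_f * (f xstar + delta) + eps ^+ 2).
      rewrite big_const_seq count_predT iter_addr_0 -mulr_natr.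
      by field; rewrite gt_eqF.
    rewrite -sumrB; apply: le_trans sum_a.
    by apply: ler_sum => k _; rewrite /a; lra.
  rewrite lerBlDr -(ler_pM2r n0); apply: le_trans sum_f.
  exact: (subdifferentiable_mean hQconvex hfsubdiff I_N0 QI).
(* Every point averaged has passed the productivity test, so Jensen's inequality transfers its bound
   to the mean. *)
- rewrite -(ler_pM2r n0).
  apply: (le_trans (subdifferentiable_mean hQconvex hgsubdiff I_N0 QI)).
  rewrite mulr_natr -iter_addr_0 -(count_predT I) -big_const_seq.
  rewrite big_seq [leRHS]big_seq; apply: ler_sum => k.
  by rewrite mem_filter => /andP[].
Qed.
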